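(* Let $g\in\mathbb X(\mathbb C)$ be a formal power series with radius of convergence $r(g)\in[0,+\infty]$, and let $T_g:\mathbb X_g\to\mathbb X(\mathbb C)$, $T_g(f)=g\circ f$. Then: (a) if $r(g)=0$, then $T_g$ is smooth; (b) if $r(g)>0$, then $T_g$ is smooth at every point $f=\sum_{n=0}^\infty a_nz^n\in\mathbb X_g$ such that (1) $|a_0|<r(g)$, or (2) $r(g)<+\infty$, $|a_0|=r(g)$ and $\deg(f)>0$.
   Context: $\mathbb N_0$ is the set of nonnegative integers. $\mathbb X(\mathbb C)$ is the set of all formal power series $f=\sum_{n=0}^\infty a_nz^n$ with $a_n\in\mathbb C$, with the Cauchy product; $\deg(f)=\max\{n:a_n\ne0\}\in\mathbb N_0\cup\{+\infty\}$ (so $\deg(f)>0$ means that some $a_n$ with $n\ge1$ is nonzero). General composition: for $g=\sum_{k=0}^\infty b_kz^k\in\mathbb X(\mathbb C)$ let $\mathbb X_g$ be the set of all $f=\sum a_nz^n\in\mathbb X(\mathbb C)$ such that for every $n\in\mathbb N_0$ the series $\sum_{k=0}^\infty b_ka_n^{(k)}$ converges in $\mathbb C$, where $a_n^{(k)}$ is the coefficient of $z^n$ in $f^k$ ($f^0=1$). For $f\in\mathbb X_g$ put $g\circ f=\sum_{n=0}^\infty c_nz^n$ with $c_n=\sum_{k=0}^\infty b_ka_n^{(k)}$. Fréchet structure: via $\sum a_nz^n\mapsto(a_0,a_1,\dots)$, $\mathbb X(\mathbb C)$ is identified (by one global chart) with the Fréchet space of all complex sequences with seminorms $\|(a_n)\|_k=|a_k|$,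 $k\in\mathbb N_0$ (topology of coefficientwise convergence). $\mathbb X_g$ carries the subspace topology; it need not be open. Smoothness: the derivative of $T_g$ at $w\in\mathbb X_g$ in direction $k\in\mathbb X(\mathbb C)$ is $dT_g(w)(k)=\lim_{t\to0}\frac{T_g(w+tk)-T_g(w)}t$ if it exists, where $t$ ranges over nonzero scalars in $\mathbb C$ and, for $w$ on the boundary of $\mathbb X_g$, the limit is restricted to sequences $t_n\to0$ with $w+t_nk\in\mathbb X_g$ for all $n$ (only directions $k$ for which such sequences exist are considered). Higher derivatives are defined iteratively, $d^mT_g(w)(k_1,\dots,k_m)=\lim_{t\to0}\frac1t\big(d^{m-1}T_g(w+tk_m)(k_1,\dots,k_{m-1})-d^{m-1}T_g(w)(k_1,\dots,k_{m-1})\big)$, with the same convention on $t$. $T_g$ is smooth ($C^\infty$) at the points of a given set $S\subset\mathbb X_g$ if it is continuous there and for each $m\ge1$ all derivatives of order $m$ exist at the points of $S$ and depend continuously on $(w,k_1,\dots,k_m)$, $w\in S$; $T_g$ is smooth if this holds with $S=\mathbb X_g$. *)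

(* Defs.v *)
From HB Require Import structures.
From mathcomp Require Import all_boot all_order all_algebra.
From mathcomp Require Import all_classical all_reals all_analysis.
From mathcomp Require Import complex.

Set Implicit Arguments.
Unset Strict Implicit.
Unset Printing Implicit Defensive.

Import Order.TTheory GRing.Theory Num.Theory.
Import numFieldNormedType.Exports.

Local Open Scope classical_set_scope.
Local Open Scope ring_scope.

(* Typing R[i] as a numClosedFieldType gives access to the topology that
   MathComp-Analysis puts on every numeric field; R[i] alone has none. *)
Definition Cplx (R : realType) : numClosedFieldType := R[i].

(* The modulus as an element of R (the ring norm `|z| lives in R[i]). *)
Definition modulus (R : realType) (z : Cplx R) : R := ComplexField.Normc.normc z.

(* f = \sum_n f n * z ^ n. *)
Definition fps (R : realType) : Type := nat -> Cplx R.

(* The vector space structure is that of nat -> C; the topology is the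
   Frechet topology of coefficientwise convergence. *)
HB.instance Definition _ (R : realType) :=
  GRing.Lmodule.copy (fps R) (nat -> Cplx R).
HB.instance Definition _ (R : realType) :=
  Uniform.copy (fps R) {ptws nat -> Cplx R}.
HB.instance Definition _ (R : realType) :=
  isPointed.Build (fps R) (0 : nat -> Cplx R).

Section FormalPowerSeries.
Variable R : realType.
Implicit Types (f g w : fps R) (n k m : nat).

Definition fps_one : fps R := fun n => (n == 0)%:R.

Definition fps_mul f g : fps R :=
  fun n => \sum_(i < n.+1) f i * g (n - i)%N.

Definition fps_exp f k : fps R := iter k (fps_mul f) fps_one.

(* Equal to -oo for f = 0, and to the largest n with f n != 0 if there is
   one. *)
Definition fps_deg f : \bar R := ereal_sup [set n%:R%:E | n in [set n | f n != 0]].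

Definition radius_of_convergence g : \bar R :=
  ereal_sup [set (modulus z)%:E | z in
    [set z : Cplx R | cvgn (series (fun n => g n * z ^+ n))]].

Definition comp_series g f n : nat -> Cplx R :=
  series (fun k => g k * fps_exp f k n).

Definition comp_dom g : set (fps R) :=
  [set f | forall n, cvgn (comp_series g f n)].

(* Meaningful for f in comp_dom g. *)
Definition fps_comp g f : fps R := fun n => limn (comp_series g f n).

Definition admissible g w (v : fps R) : Prop :=
  exists t : nat -> Cplx R,
    [/\ forall n, t n != 0, t @ \oo --> (0 : Cplx R) &
        forall n, comp_dom g (w + t n *: v)].

(* t -> 0 through the t != 0 such that w + t v lies in comp_dom g; this
   filter is proper exactly when v is admissible at w. *)
Definition increments g w (v : fps R) : set_system (Cplx R) :=
  within [set t | comp_dom g (w + t *: v)] (0 : Cplx R)^'.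

Definition front_dirs m (v : 'I_m.+1 -> fps R) : 'I_m -> fps R :=
  fun i => v (widen_ord (leqnSn m) i).

Definition diff_quotient (F : fps R -> fps R) w (v : fps R) (t : Cplx R) : fps R :=
  t^-1 *: (F (w + t *: v) - F w).

(* The value of d^m T_g (w) (v_0, ..., v_(m-1)), meaningful when has_dT. *)
Fixpoint dT g m : fps R -> ('I_m -> fps R) -> fps R :=
  match m with
  | 0 => fun w _ => fps_comp g w
  | m'.+1 => fun w v =>
      lim (diff_quotient (fun x => dT g x (front_dirs v)) w (v ord_max)
             @ increments g w (v ord_max))
  end.

Fixpoint has_dT g m : fps R -> ('I_m -> fps R) -> Prop :=
  match m with
  | 0 => fun w _ => comp_dom g w
  | m'.+1 => fun w v =>
      [/\ admissible g w (v ord_max),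
          has_dT g w (front_dirs v),
          \forall t \near increments g w (v ord_max),
            has_dT g (w + t *: v ord_max) (front_dirs v) &
          cvg (diff_quotient (fun x => dT g x (front_dirs v)) w (v ord_max)
                 @ increments g w (v ord_max))]
  end.

Definition smooth_at_points g (S : set (fps R)) : Prop :=
  [/\ S `<=` comp_dom g,
      forall f, S f ->
        fps_comp g x @[x --> within (comp_dom g) (nbhs f)] --> fps_comp g f &
      forall m, (1 <= m)%N ->
        (forall w (v : 'I_m -> fps R), S w ->
           (forall i, admissible g w (v i)) -> has_dT g w v) /\
        {within [set p : fps R * {ptws 'I_m -> fps R} |
                  S p.1 /\ forall i, admissible g p.1 (p.2 i)],
           continuous (fun p : fps R * {ptws 'I_m -> fps R} => dT g p.1 p.2)}].

Definition smooth g : Prop := smooth_at_points g (comp_dom g).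

End FormalPowerSeries.

(* Main.v *)
Require Import Defs.
From mathcomp Require Import all_boot all_order all_algebra.
From mathcomp Require Import all_classical all_reals all_analysis.
From mathcomp Require Import complex.
From mathcomp Require Import ring lra zify.

(** The theorem holds because all derivatives of T_g are given by one formula,
    the chain rule
      d^m T_g (w) (v_1, ..., v_m) = (g^(m) o w) v_1 ... v_m,
    where g^(m) is the m-th formal derivative and the products are those of
    power series; its right hand side is continuous in w and in the v_i.

    What has to be shown is that g o w may be differentiated term by term. The
    coefficient of degree n of w^k is bounded by that of P^k as soon as the
    polynomial P dominates the coefficients of w up to n. So fix rho and
    suppose that the series of |g_k| (P^k)_n is bounded for each n and each P
    with nonnegative coefficients and constant coefficient rho
    ([majorant_summable]). Then on the set of all w with |w_0| <= rho the
    composition exists ([summable_comp_dom]), and dominated convergence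
    ([tannery]) shows that it is continuous ([fps_comp_cvg]) and satisfies the
    chain rule for one derivative ([fps_comp_derivative]). The property passes
    from g to g' at the same rho ([summable_deriv]), so it holds for every
    g^(m) and induction gives the formula ([dT_regular]). The constraint |w_0|
    <= rho, rather than a neighbourhood of w, makes the argument work on the
    boundary of the domain of T_g.

    It remains to find rho ([regular_at]). If r(g) = 0 the domain consists of
    the w with w_0 = 0, and rho = 0 is suitable for any g ([summable0]). If
    |w_0| < r(g), any rho strictly between is suitable ([summable_lt]). If
    |w_0| = r(g) and w is not constant, let p be the order of w - w_0.
    Expanding w^k in powers of w - w_0, the convergence of g o w in the
    degrees 0, p, 2p, ... shows in turn that the series of each derivative of
    g has bounded partial sums at w_0 ([comp_dom_weight]). Hence its terms are
    bounded even after multiplication by any power of k, all these series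
    converge absolutely on the closed disc, and rho = r(g) is suitable
    ([summable_nonconst]). *)

Set Implicit Arguments.
Unset Strict Implicit.
Unset Printing Implicit Defensive.

Import Order.TTheory GRing.Theory Num.Theory.
Import numFieldNormedType.Exports.

Local Open Scope complex_scope.
Local Open Scope classical_set_scope.
Local Open Scope ring_scope.

(* The closure lemmas of polyOver are attached to the predicate underlying
   Num.nneg. *)
Local Notation nneg_poly := (polyOver Num.Def.nneg_num_pred).

(** * Convergence in terms of the modulus *)

Lemma normrE_modulus (R : realType) (z : Cplx R) : `|z| = (modulus z)%:C.
Proof. by []. Qed.

Lemma modulus_ge0 (R : realType) (z : Cplx R) : 0 <= modulus z.
Proof. by rewrite -ler0c -normrE_modulus normr_ge0. Qed.

Lemma modulus0 (R : realType) : modulus (0 : Cplx R) = 0.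
Proof. exact: ComplexField.Normc.normc0. Qed.

Lemma modulus1 (R : realType) : modulus (1 : Cplx R) = 1.
Proof. exact: ComplexField.Normc.normc1. Qed.

Lemma modulusM (R : realType) (y z : Cplx R) :
  modulus (y * z) = modulus y * modulus z.
Proof. exact: ComplexField.Normc.normcM. Qed.

Lemma modulusX (R : realType) (z : Cplx R) n : modulus (z ^+ n) = modulus z ^+ n.
Proof.
by elim: n => [|n IH]; rewrite ?expr0 ?modulus1// !exprS modulusM IH.
Qed.

Lemma modulus_nat (R : realType) n : modulus (n%:R : Cplx R) = n%:R.
Proof. by apply: complexI; rewrite -normrE_modulus normr_nat rmorph_nat. Qed.

Lemma modulusR (R : realType) (x : R) : 0 <= x -> modulus (x%:C : Cplx R) = x.
Proof.
by move=> x0; apply: complexI; rewrite -normrE_modulus ger0_norm ?ler0c.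
Qed.

Lemma modulusN (R : realType) (z : Cplx R) : modulus (- z) = modulus z.
Proof. by apply: complexI; rewrite -!normrE_modulus normrN. Qed.

Lemma modulus_eq0 (R : realType) (z : Cplx R) : (modulus z == 0) = (z == 0).
Proof.
by rewrite -[RHS]normr_eq0 normrE_modulus -(inj_eq (@complexI R)).
Qed.

Lemma le_modulusD (R : realType) (y z : Cplx R) :
  modulus (y + z) <= modulus y + modulus z.
Proof. by rewrite -lecR rmorphD -!normrE_modulus ler_normD. Qed.

Lemma le_modulus_sum (R : realType) (I : Type) (r : seq I) (P : pred I)
    (F : I -> Cplx R) :
  modulus (\sum_(i <- r | P i) F i) <= \sum_(i <- r | P i) modulus (F i).
Proof.
elim/big_rec2: _ => [|i y x _ IH]; first by rewrite modulus0.
by rewrite (le_trans (le_modulusD _ _))// lerD2l.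
Qed.

(** The norm of the field of complex numbers takes complex values; this is the
    epsilon criterion with a real epsilon. *)
Lemma cvg_modulusP (R : realType) (T : Type) (F : set_system T) {FF : Filter F}
    (u : T -> Cplx R) (l : Cplx R) :
  u x @[x --> F] --> l <->
  forall e : R, 0 < e -> \forall x \near F, modulus (l - u x) < e.
Proof.
split=> [/cvgrPdist_lt H e e0|H].
  have := H e%:C; rewrite ltcR => /(_ e0); apply: filterS => x.
  by rewrite normrE_modulus ltcR.
apply/cvgrPdist_lt => e e0.
have eE : e = (complex.Re e)%:C by rewrite RRe_real// realE ltW.
move: e0; rewrite eE ltcR => e0; apply: filterS (H _ e0) => x.
by rewrite normrE_modulus ltcR.
Qed.

(** * Series of nonnegative terms with bounded partial sums *)

(** Summability of a nonnegative sequence, stated in the form that comparison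
    and finite sums preserve directly. *)
Definition bounded_sums (R : realType) (B : nat -> R) : Prop :=
  exists M, forall N, \sum_(k < N) B k <= M.

Lemma bounded_sums_tail (R : realType) (B : nat -> R) (e : R) :
  (forall k, 0 <= B k) -> bounded_sums B -> 0 < e ->
  exists K, forall N, (K <= N)%N -> \sum_(K <= k < N) B k < e.
Proof.
move=> B0 [M BM] e0.
(* K is an index whose partial sum is within e of the supremum of all. *)
pose A := [set x : R | exists N, x = \sum_(k < N) B k].
have supA : has_sup A.
  split; first by exists (\sum_(k < 0) B k); exists 0%N.
  by exists M => _ [N ->].
have [_ [K ->] lK] := sup_adherent e0 supA.
exists K => N KN.
have E : \sum_(k < N) B k = \sum_(k < K) B k + \sum_(K <= k < N) B k.
  by rewrite -!(big_mkord xpredT B) -big_cat_nat.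
have : \sum_(i < N) B i <= sup A.
  by apply: sup_ubound; [case: supA|exists N].
lra.
Qed.

Lemma bounded_sums_le (R : realType) (A B : nat -> R) :
  (forall k, A k <= B k) -> bounded_sums B -> bounded_sums A.
Proof.
move=> AB [M BM]; exists M => N; apply: le_trans (BM N).
by apply: ler_sum.
Qed.

Lemma bounded_sumsM (R : realType) (A : nat -> R) (c : R) :
  0 <= c -> bounded_sums A -> bounded_sums (fun k => A k * c).
Proof.
move=> c0 [M AM]; exists (M * c) => N; by rewrite -mulr_suml ler_wpM2r.
Qed.

Lemma bounded_sums_sum (R : realType) (n : nat) (A : nat -> nat -> R) :
  (forall i, (i < n)%N -> bounded_sums (A i)) ->
  bounded_sums (fun k => \sum_(i < n) A i k).
Proof.
elim: n => [|n IH] H.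
  by exists 0 => N; rewrite big1// => k _; rewrite big_ord0.
have [M MP] := IH (fun i Hi => H i (ltnW Hi)); have [M' MP'] := H n (ltnSn n).
exists (M + M') => N; under eq_bigr do rewrite big_ord_recr/=.
by rewrite big_split lerD.
Qed.

(** The maximum allows for a first term of any sign, the empty sum being 0. *)
Lemma bounded_sums_shift (R : realType) (B : nat -> R) :
  bounded_sums (fun k => B k.+1) -> bounded_sums B.
Proof.
move=> [M BM]; exists (Num.max 0 (B 0%N + M)) => -[|N].
  by rewrite big_ord0 le_max lexx.
by rewrite big_ord_recl le_max lerD2l BM orbT.
Qed.

(** * Absolute convergence and dominated convergence *)

Lemma cvg_complex (R : realType) (u : nat -> Cplx R) (a b : R) :
  (fun n => complex.Re (u n)) @ \oo --> a ->
  (fun n => complex.Im (u n)) @ \oo --> b ->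
  u @ \oo --> (Complex a b : Cplx R).
Proof.
move=> ua ub; apply/cvg_modulusP => e e0.
have e20 : 0 < e / 2 by lra.
have /cvgrPdist_lt/(_ _ e20) := ua; have /cvgrPdist_lt/(_ _ e20) := ub.
apply: filterS2 => n hb ha.
have -> : (Complex a b : Cplx R) - u n =
    ((a - complex.Re (u n))%:C + 'i%C * (b - complex.Im (u n))%:C : Cplx R).
  by rewrite [LHS]complexE; case: (u n).
have modR (x : R) : modulus (x%:C : Cplx R) = `|x|.
  by rewrite /modulus /= expr0n/= addr0 sqrtr_sqr.
have modi : modulus ('i%C : Cplx R) = 1.
  by rewrite /modulus /= expr0n/= add0r expr1n sqrtr1.
rewrite (le_lt_trans (le_modulusD _ _))// modulusM modi mul1r !modR; lra.
Qed.

Lemma ReIm_modulus (R : realType) (z : Cplx R) :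
  `|complex.Re z| <= modulus z /\ `|complex.Im z| <= modulus z.
Proof.
case: z => a b; rewrite /modulus/=; split.
  by rewrite -(sqrtr_sqr a) ler_wsqrtr// lerDl sqr_ge0.
by rewrite -(sqrtr_sqr b) ler_wsqrtr// lerDr sqr_ge0.
Qed.

Lemma real_series_cvg (R : realType) (u B : nat -> R) :
  (forall k, `|u k| <= B k) -> bounded_sums B -> cvgn (series u).
Proof.
move=> uB [M BM]; have B0 k : 0 <= B k by apply: le_trans (uB k).
have cB : cvgn (series B).
  apply: nondecreasing_is_cvgn.
    apply/nondecreasing_seqP => n; rewrite !seriesEnat/= big_nat_recr//= lerDl.
    exact: B0.
  by exists M => _ [N _ <-]; rewrite seriesEnat/= big_mkord.
apply: normed_cvg; apply: (series_le_cvg _ B0 uB cB) => k; exact: normr_ge0.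
Qed.

(** Completeness of the complex numbers enters here, through the real and
    imaginary parts. *)
Lemma complex_series_cvg (R : realType) (u : nat -> Cplx R) (B : nat -> R) :
  (forall k, modulus (u k) <= B k) -> bounded_sums B -> cvgn (series u).
Proof.
move=> uB BB.
have /cvg_ex[a ha] : cvgn (series (fun k => complex.Re (u k))).
  by apply: real_series_cvg BB => k; apply: le_trans (uB k);
    case: (ReIm_modulus (u k)).
have /cvg_ex[b hb] : cvgn (series (fun k => complex.Im (u k))).
  by apply: real_series_cvg BB => k; apply: le_trans (uB k);
    case: (ReIm_modulus (u k)).
apply/cvg_ex; exists (Complex a b : Cplx R); apply: cvg_complex.
- suff -> : (fun n => complex.Re (series u n)) =
      series (fun k => complex.Re (u k)).
    exact: ha.
  apply/funext => n; rewrite !seriesEnat/=.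
  by elim: n => [|n IH]; rewrite ?big_nil// !big_nat_recr//= raddfD/= IH.
- suff -> : (fun n => complex.Im (series u n)) =
      series (fun k => complex.Im (u k)).
    exact: hb.
  apply/funext => n; rewrite !seriesEnat/=.
  by elim: n => [|n IH]; rewrite ?big_nil// !big_nat_recr//= raddfD/= IH.
Qed.

(** The error made by cutting a series at K is controlled by the tails of any
    dominating series. *)
Lemma series_tail_le (R : realType) (u : nat -> Cplx R) (B : nat -> R) (K : nat)
    (e : R) :
  (forall k, modulus (u k) <= B k) -> bounded_sums B ->
  (forall N, (K <= N)%N -> \sum_(K <= k < N) B k < e) ->
  modulus (limn (series u) - series u K) <= e.
Proof.
move=> uB bB tl; have cu := complex_series_cvg uB bB.
apply/ler_addgt0Pl => d d0.
have /cvg_modulusP/(_ _ d0)[N _ HN] := cu.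
have {HN} := HN (maxn N K) (leq_maxl _ _).
have KN : (K <= maxn N K)%N := leq_maxr _ _.
move: (maxn N K) KN => {}N KN lN.
have -> : limn (series u) - series u K
    = (limn (series u) - series u N) + (series u N - series u K).
  by rewrite addrA subrK.
rewrite (le_trans (le_modulusD _ _))// lerD ?(ltW lN)//.
rewrite (_ : series u N - series u K = \sum_(K <= k < N) u k); last first.
  by rewrite !seriesEnat/= (big_cat_nat _ KN)//= addrAC subrr add0r.
rewrite (le_trans (le_modulus_sum _ _ _))// (le_trans _ (ltW (tl _ KN)))//.
exact: ler_sum.
Qed.

Lemma cvg_big_sum (R : realType) (T I : Type) (F : set_system T) {FF : Filter F}
    (r : seq I) (u : I -> T -> Cplx R) (l : I -> Cplx R) :
  (forall i, u i t @[t --> F] --> l i) ->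
  (\sum_(i <- r) u i t) @[t --> F] --> \sum_(i <- r) l i.
Proof.
move=> ul; elim: r => [|i r IH].
  rewrite big_nil (_ : (fun t => _) = fun=> 0); first exact: cvg_cst.
  by apply/funext => t; rewrite big_nil.
rewrite big_cons (_ : (fun t => _) = fun t => u i t + \sum_(j <- r) u j t).
  exact: (cvgD (ul i) IH).
by apply/funext => t; rewrite big_cons.
Qed.

(** Tannery's theorem: the summable bound makes the tails uniformly small in
    t, and finite sums pass to the limit termwise. *)
Lemma tannery (R : realType) (T : Type) (F : set_system T) {FF : Filter F}
    (u : T -> nat -> Cplx R) (l : nat -> Cplx R) (B : nat -> R) :
  bounded_sums B ->
  (forall k, modulus (l k) <= B k) ->
  (\forall t \near F, forall k, modulus (u t k) <= B k) ->
  (forall k, u t k @[t --> F] --> l k) ->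
  limn (series (u t)) @[t --> F] --> limn (series l).
Proof.
move=> bB lB uB ul; apply/cvg_modulusP => e e0.
have e30 : 0 < e / 3 by lra.
have B0 k : 0 <= B k by apply: le_trans (lB k); exact: modulus_ge0.
(* e / 3 for each of the two tails and e / 3 for the sums of K terms. *)
have [K HK] := bounded_sums_tail B0 bB e30.
have : (series (u t) K) @[t --> F] --> series l K by exact: cvg_big_sum.
move=> /cvg_modulusP/(_ _ e30); apply: filterS2 uB => t tB tK.
have := series_tail_le lB bB HK; have := series_tail_le tB bB HK.
set a := limn _; set b := limn _ => a1 b1.
have -> : b - a = (b - series l K) + ((series l K - series (u t) K)
     + - (a - series (u t) K)) by ring.
have := le_modulusD (b - series l K) ((series l K - series (u t) K)
     + - (a - series (u t) K)).
have := le_modulusD (series l K - series (u t) K) (- (a - series (u t) K)).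
rewrite modulusN; lra.
Qed.

(** * Powers of power series as powers of polynomials *)

(** The coefficient of degree n of a power of f depends only on the
    coefficients of f up to n. Truncating at n moves the computation to a
    commutative polynomial ring, where the binomial formula and geometric
    factorizations are at hand. *)
Definition trunc (R : realType) (n : nat) (f : fps R) : {poly Cplx R} :=
  \poly_(i < n.+1) f i.

Lemma coef_trunc (R : realType) n (f : fps R) i :
  (i <= n)%N -> (trunc n f)`_i = f i.
Proof. by move=> lin; rewrite coef_poly ltnS lin. Qed.

Lemma coef_trunc_exp (R : realType) n (f : fps R) k i :
  (i <= n)%N -> (trunc n f ^+ k)`_i = fps_exp f k i.
Proof.
elim: k i => [|k IH] i lin; first by rewrite expr0 coef1.
rewrite exprS coefM /fps_exp iterS; apply: eq_bigr => j _.
rewrite coef_trunc ?IH//; first by rewrite (leq_trans (leq_subr _ _)).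
by rewrite (leq_trans _ lin)// -ltnS.
Qed.

(** The Cauchy product is a polynomial with nonnegative coefficients in the
    coefficients of its factors, so coefficientwise domination is
    multiplicative. *)
Lemma coefM_majorant (R : realType) (p q : {poly Cplx R}) (P Q : {poly R}) n :
  (forall i, (i <= n)%N -> modulus p`_i <= P`_i) ->
  (forall i, (i <= n)%N -> modulus q`_i <= Q`_i) ->
  forall i, (i <= n)%N -> modulus (p * q)`_i <= (P * Q)`_i.
Proof.
move=> pP qQ i lin; rewrite !coefM (le_trans (le_modulus_sum _ _ _))//.
apply: ler_sum => j _; rewrite modulusM ler_pM ?modulus_ge0// ?pP ?qQ//.
  by rewrite (leq_trans _ lin)// -ltnS.
by rewrite (leq_trans (leq_subr _ _)).
Qed.

Lemma coefX_majorant (R : realType) (p : {poly Cplx R}) (P : {poly R}) n k :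
  (forall i, (i <= n)%N -> modulus p`_i <= P`_i) ->
  forall i, (i <= n)%N -> modulus (p ^+ k)`_i <= (P ^+ k)`_i.
Proof.
move=> pP; elim: k => [|k IH]; last by rewrite !exprS; exact: coefM_majorant.
by move=> i _; rewrite !expr0 !coef1 modulus_nat.
Qed.

(** * Majorant summability and continuity of the composition *)

Lemma nneg_poly_coef_ge0 (R : realType) (P : {poly R}) i :
  P \is a nneg_poly -> 0 <= P`_i.
Proof. by move=> /polyOverP/(_ i). Qed.

(** For rho >= 0 this says that the series of the absolute values of g can be
    composed with every f whose constant coefficient has modulus at most rho,
    whatever the other coefficients are. It is the one analytic hypothesis
    behind continuity and differentiability. As each degree sees finitely many
    coefficients, polynomials P are enough. *)
Definition majorant_summable (R : realType) (g : fps R) (rho : R) : Prop :=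
  forall P : {poly R}, P \is a nneg_poly -> P`_0 = rho ->
  forall n, bounded_sums (fun k => modulus (g k) * (P ^+ k)`_n).

(** The constant coefficient is kept apart: it has to be exactly rho. *)
Definition majorant (R : realType) n (rho : R) (c : nat -> R) : {poly R} :=
  \poly_(i < n.+1) (if i == 0%N then rho else c i).

Lemma majorant_nneg (R : realType) n (rho : R) (c : nat -> R) :
  0 <= rho -> (forall i, 0 <= c i) -> majorant n rho c \is a nneg_poly.
Proof.
move=> r0 c0; apply/polyOverP => i; rewrite coef_poly -topredE/=.
by case: ifP => // _; case: ifP.
Qed.

Lemma coef0_majorant (R : realType) n (rho : R) (c : nat -> R) :
  (majorant n rho c)`_0 = rho.
Proof. by rewrite coef_poly. Qed.

Lemma trunc_majorant (R : realType) n (rho : R) (c : nat -> R) (f : fps R) :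
  modulus (f 0%N) <= rho ->
  (forall i, (i <= n)%N -> modulus (f i) <= c i) ->
  forall i, (i <= n)%N -> modulus (trunc n f)`_i <= (majorant n rho c)`_i.
Proof.
move=> f0 fc i lin; rewrite coef_trunc// coef_poly ltnS lin.
by case: eqP => [->//|_]; exact: fc.
Qed.

Lemma summable_comp_dom (R : realType) (g f : fps R) (rho : R) :
  majorant_summable g rho -> modulus (f 0%N) <= rho -> comp_dom g f.
Proof.
move=> Q f0 n; have r0 : 0 <= rho by apply: le_trans f0; exact: modulus_ge0.
pose P := majorant n rho (fun i => modulus (f i)).
have P0 : P \is a nneg_poly.
  by apply: majorant_nneg => // i; exact: modulus_ge0.
apply: (complex_series_cvg _ (Q P P0 (coef0_majorant _ _ _) n)) => k.
rewrite modulusM ler_wpM2l ?modulus_ge0// -(@coef_trunc_exp _ n)//.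
by apply: (coefX_majorant (n := n)) => // i; exact: trunc_majorant.
Qed.

Lemma cvg_fps_mul (R : realType) (T : Type) (F : set_system T) {FF : Filter F}
    (a b : T -> fps R) (f g : fps R) :
  (forall i, a t i @[t --> F] --> f i) -> (forall i, b t i @[t --> F] --> g i) ->
  forall n, fps_mul (a t) (b t) n @[t --> F] --> fps_mul f g n.
Proof.
by move=> af bg n; apply: cvg_big_sum => i; apply: cvgM; [exact: af|exact: bg].
Qed.

Lemma cvg_fps_exp (R : realType) (T : Type) (F : set_system T) {FF : Filter F}
    (a : T -> fps R) (f : fps R) k :
  (forall i, a t i @[t --> F] --> f i) ->
  forall n, fps_exp (a t) k n @[t --> F] --> fps_exp f k n.
Proof.
move=> af; elim: k => [|k IH] n; first exact: cvg_cst.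
exact: cvg_fps_mul.
Qed.

Lemma near_coef_bounded (R : realType) (T : Type) (F : set_system T)
    {FF : Filter F} (a : T -> fps R) (f : fps R) n :
  (forall i, a t i @[t --> F] --> f i) ->
  \forall t \near F, forall i, (i <= n)%N -> modulus (a t i) <= modulus (f i) + 1.
Proof.
move=> af.
have H (i : 'I_n.+1) : \forall t \near F, modulus (a t i) <= modulus (f i) + 1.
  have /cvg_modulusP/(_ _ ltr01) := af i; apply: filterS => t.
  have := le_modulusD (f i) (- (f i - a t i)).
  rewrite modulusN (_ : f i + - (f i - a t i) = a t i); last by ring.
  lra.
have := filter_forall FF H; apply: filterS => t Ht i lin.
exact: (Ht (Ordinal (lin : (i < n.+1)%N))).
Qed.

(** Near f the coefficients up to n are bounded by those of one majorant,
    whose constant coefficient is rho thanks to the constraint on the disc;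
    dominated convergence then applies degree by degree. *)
Lemma fps_comp_cvg (R : realType) (T : Type) (F : set_system T)
    {FF : Filter F} (g : fps R) (rho : R) (a : T -> fps R) (f : fps R) :
  majorant_summable g rho -> modulus (f 0%N) <= rho ->
  (\forall t \near F, modulus (a t 0%N) <= rho) ->
  (forall i, a t i @[t --> F] --> f i) ->
  forall n, fps_comp g (a t) n @[t --> F] --> fps_comp g f n.
Proof.
move=> Q f0 a0 af n; have r0 : 0 <= rho by apply: le_trans f0; exact: modulus_ge0.
pose P := majorant n rho (fun i => modulus (f i) + 1).
have P0 : P \is a nneg_poly.
  by apply: majorant_nneg => // i; rewrite addr_ge0 ?modulus_ge0.
have bnd (h : fps R) : modulus (h 0%N) <= rho ->
    (forall i, (i <= n)%N -> modulus (h i) <= modulus (f i) + 1) ->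
    forall k, modulus (g k * fps_exp h k n) <= modulus (g k) * (P ^+ k)`_n.
  move=> h0 hf k; rewrite modulusM ler_wpM2l ?modulus_ge0//.
  rewrite -(@coef_trunc_exp _ n)//.
  by apply: (coefX_majorant (n := n)) => // i; exact: trunc_majorant.
apply: (@tannery _ _ _ _ (fun t k => g k * fps_exp (a t) k n) _ _
  (Q P P0 (coef0_majorant _ _ _) n)).
- by apply: bnd => // i _; rewrite lerDl.
- by apply: filterS2 a0 (near_coef_bounded n af) => t; exact: bnd.
- by move=> k; apply: cvgM; [exact: cvg_cst|exact: cvg_fps_exp].
Qed.

(** * The first derivative of the composition *)

Definition fps_deriv (R : realType) (g : fps R) : fps R :=
  fun k => k.+1%:R * g k.+1.

(** The derivative of a power of P is bounded, one degree up, by a power of P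
    + X, whose constant coefficient is that of P. *)
Lemma exp_addX_ge (R : realType) (P : {poly R}) k n :
  P \is a nneg_poly ->
  k.+1%:R * (P ^+ k)`_n <= ((P + 'X) ^+ k.+1)`_n.+1.
Proof.
move=> P0; have X0 : ('X : {poly R}) \is a nneg_poly by rewrite polyOverX.
have PX0 : P + 'X \is a nneg_poly by rewrite rpredD.
have PPX j : (P + 'X) ^+ j - P ^+ j \is a nneg_poly.
  rewrite subrXX addrAC subrr add0r rpredM// rpred_sum// => i _.
  by rewrite rpredM// rpredX.
(* Factoring X out of (P + X)^(k+1) - P^(k+1) leaves k+1 products of powers
   of P + X and P, each of which dominates P^k. *)
have H : (P + 'X) ^+ k.+1 - P ^+ k.+1 - 'X * P ^+ k *+ k.+1
    \is a nneg_poly.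
  rewrite subrXX addrAC subrr add0r.
  rewrite -mulrnAr (_ : P ^+ k *+ k.+1 =
      \sum_(i < k.+1) P ^+ (k.+1.-1 - i) * P ^+ i); last first.
    rewrite -[X in _ *+ X]card_ord -sumr_const; apply: eq_bigr => i _.
    by rewrite -exprD subnK// -ltnS.
  rewrite -mulrBr rpredM// -sumrB rpred_sum// => i _.
  by rewrite -mulrBl rpredM// rpredX.
have := nneg_poly_coef_ge0 n.+1 H.
have := nneg_poly_coef_ge0 n.+1 (rpredX k.+1 P0).
rewrite !coefB coefMn coefXM/= mulr_natl; lra.
Qed.

(** Differentiating g costs nothing: the factor k + 1 is absorbed by replacing
    the majorant P by P + X, without enlarging rho. *)
Lemma summable_deriv (R : realType) (g : fps R) (rho : R) :
  majorant_summable g rho -> majorant_summable (fps_deriv g) rho.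
Proof.
move=> Q P P0 Pr n.
have PX0 : P + 'X \is a nneg_poly by rewrite rpredD// polyOverX.
have := Q _ PX0; rewrite coefD coefX addr0 => /(_ Pr n.+1)[M HM].
(* g' at k only sees g at k + 1, hence one more term on the right. *)
exists M => N; rewrite (le_trans _ (HM N.+1))// big_ord_recl/=.
rewrite -[leLHS]add0r lerD ?mulr_ge0 ?modulus_ge0 ?nneg_poly_coef_ge0 ?rpredX//.
apply: ler_sum => k _; rewrite modulusM modulus_nat mulrAC mulrC.
by rewrite ler_wpM2l ?modulus_ge0// exp_addX_ge.
Qed.

Lemma cvg_coefM (R : realType) (T : Type) (F : set_system T) {FF : Filter F}
    (a b : T -> {poly Cplx R}) (p q : {poly Cplx R}) :
  (forall i, (a t)`_i @[t --> F] --> p`_i) ->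
  (forall i, (b t)`_i @[t --> F] --> q`_i) ->
  forall i, (a t * b t)`_i @[t --> F] --> (p * q)`_i.
Proof.
move=> ap bq i; rewrite coefM (_ : (fun t => _) =
  fun t => \sum_(j < i.+1) (a t)`_j * (b t)`_(i - j)); last first.
  by apply/funext => t; rewrite coefM.
by apply: cvg_big_sum => j; apply: cvgM; [exact: ap|exact: bq].
Qed.

Lemma cvg_coef_exp (R : realType) (T : Type) (F : set_system T) {FF : Filter F}
    (a : T -> {poly Cplx R}) (p : {poly Cplx R}) k :
  (forall i, (a t)`_i @[t --> F] --> p`_i) ->
  forall i, (a t ^+ k)`_i @[t --> F] --> (p ^+ k)`_i.
Proof.
move=> ap; elim: k => [|k IH] i; first exact: cvg_cst.
rewrite exprS (_ : (fun t => _) = fun t => (a t * a t ^+ k)`_i); last first.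
  by apply/funext => t; rewrite exprS.
exact: cvg_coefM.
Qed.

(** The divided difference ((A + t V)^k - A^k) / t, written without division
    so that it still makes sense at t = 0. *)
Definition exp_slope (R : realType) (A V : {poly Cplx R}) k (t : Cplx R)
  : {poly Cplx R} := V * \sum_(i < k) (A + t *: V) ^+ (k.-1 - i) * A ^+ i.

Lemma exp_slopeE (R : realType) (A V : {poly Cplx R}) k (t : Cplx R) :
  t *: exp_slope A V k t = (A + t *: V) ^+ k - A ^+ k.
Proof.
by rewrite subrXX [A + _ - A]addrAC subrr add0r /exp_slope scalerAl.
Qed.

Lemma exp_slope0 (R : realType) (A V : {poly Cplx R}) k :
  exp_slope A V k 0 = (V * A ^+ k.-1) *+ k.
Proof.
rewrite /exp_slope scale0r addr0 -mulrnAr; congr (_ * _).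
case: k => [|k]; first by rewrite big_ord0.
rewrite -[X in _ *+ X]card_ord -sumr_const; apply: eq_bigr => i _.
by rewrite -exprD subnK// -ltnS.
Qed.

Lemma coef_sum_cvg (R : realType) (T : Type) (F : set_system T) {FF : Filter F} k
    (a : nat -> T -> {poly Cplx R}) (p : nat -> {poly Cplx R}) :
  (forall j i, (a j t)`_i @[t --> F] --> (p j)`_i) ->
  forall i, (\sum_(j < k) a j t)`_i @[t --> F] --> (\sum_(j < k) p j)`_i.
Proof.
move=> ap i; rewrite coef_sum (_ : (fun t => _) =
  fun t => \sum_(j < k) (a j t)`_i); last first.
  by apply/funext => t; rewrite coef_sum.
by apply: cvg_big_sum => j.
Qed.

Lemma cvg_exp_slope (R : realType) (F : set_system (Cplx R)) {FF : Filter F}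
    (A V : {poly Cplx R}) k :
  t @[t --> F] --> (0 : Cplx R) ->
  forall i, (exp_slope A V k t)`_i @[t --> F] --> (exp_slope A V k 0)`_i.
Proof.
move=> F0; apply: cvg_coefM => [j|]; first exact: cvg_cst.
apply: (coef_sum_cvg _ (p := fun j => (A + 0 *: V) ^+ (k.-1 - j) * A ^+ j)
  (a := fun j t => (A + t *: V) ^+ (k.-1 - j) * A ^+ j)) => j.
apply: cvg_coefM => [|i]; last exact: cvg_cst.
apply: cvg_coef_exp => i.
rewrite coefD coefZ (_ : (fun t => _) = fun t => A`_i + t * V`_i); last first.
  by apply/funext => t; rewrite coefD coefZ.
exact: (cvgD (cvg_cst _) (cvgM F0 (cvg_cst _))).
Qed.

Lemma exp_slope_majorant (R : realType) (A V : {poly Cplx R}) (P W : {poly R})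
    k (t : Cplx R) n :
  (forall i, (i <= n)%N -> modulus A`_i <= P`_i) ->
  (forall i, (i <= n)%N -> modulus (A + t *: V)`_i <= P`_i) ->
  (forall i, (i <= n)%N -> modulus V`_i <= W`_i) ->
  modulus (exp_slope A V k t)`_n <= (W * P ^+ k.-1 *+ k)`_n.
Proof.
move=> AP AtP VW; rewrite -mulrnAr; apply: (coefM_majorant VW) => // i lin.
rewrite coef_sum (le_trans (le_modulus_sum _ _ _))//.
case: k => [|k]; first by rewrite big_ord0 mulr0n coef0.
rewrite -[X in _ *+ X]card_ord -sumr_const coef_sum; apply: ler_sum => j _.
have -> : P ^+ k.+1.-1 = P ^+ (k - j) * P ^+ j.
  by rewrite -exprD subnK// -ltnS.
by apply: coefM_majorant lin; exact: coefX_majorant.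
Qed.

Lemma trunc_line (R : realType) n (w v : fps R) (t : Cplx R) :
  trunc n (w + t *: v) = trunc n w + t *: trunc n v.
Proof.
apply/polyP => i; rewrite coefD coefZ !coef_poly.
by case: ifP => // _; rewrite mulr0 addr0.
Qed.

(** Both compositions converge, so their difference quotient is the sum of the
    divided differences of the powers. *)
Lemma diff_quotientE (R : realType) (g w v : fps R) (t : Cplx R) n :
  comp_dom g w -> comp_dom g (w + t *: v) -> t != 0 ->
  diff_quotient (fps_comp g) w v t n =
  limn (series (fun k => g k * (exp_slope (trunc n w) (trunc n v) k t)`_n)).
Proof.
move=> gw gwt t0; apply/esym/cvg_lim; first exact: norm_hausdorff.
suff -> : series (fun k => g k * (exp_slope (trunc n w) (trunc n v) k t)`_n) =
    fun N => t^-1 * (comp_series g (w + t *: v) n N - comp_series g w n N).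
  apply: cvgM; first exact: cvg_cst.
  exact: (cvgB (gwt n) (gw n)).
apply/funext => N; rewrite /comp_series !seriesEnat/= -sumrB mulr_sumr.
apply: eq_bigr => k _; rewrite -!(@coef_trunc_exp _ n)// trunc_line -mulrBr.
rewrite -coefB -exp_slopeE coefZ mulrCA; congr (_ * _).
by rewrite mulrA mulVf// mul1r.
Qed.

(** At t = 0 the slopes are k w^(k-1) v, which sum to (g' o w) v after the
    index shift that removes the vanishing term k = 0. *)
Lemma lim_slope0 (R : realType) (g w v : fps R) n :
  comp_dom (fps_deriv g) w ->
  limn (series (fun k => g k * (exp_slope (trunc n w) (trunc n v) k 0)`_n)) =
  fps_mul (fps_comp (fps_deriv g) w) v n.
Proof.
move=> gw; apply/cvg_lim; first exact: norm_hausdorff.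
rewrite -cvg_shiftS/=.
suff -> : (fun N => series (fun k =>
      g k * (exp_slope (trunc n w) (trunc n v) k 0)`_n) N.+1) =
    fun N => \sum_(i < n.+1) comp_series (fps_deriv g) w i N * v (n - i)%N.
  by apply: cvg_big_sum => i; apply: cvgM; [exact: gw|exact: cvg_cst].
apply/funext => N; rewrite seriesEnat/= big_mkord big_ord_recl/=.
rewrite exp_slope0 mulr0n coef0 mulr0 add0r.
under [RHS]eq_bigr do rewrite /comp_series seriesEnat/= big_mkord mulr_suml.
rewrite exchange_big; apply: eq_bigr => k _ /=.
rewrite exp_slope0 /bump leq0n add1n/= coefMn [trunc n v * _]mulrC coefM.
rewrite -mulr_natl !mulr_sumr; apply: eq_bigr => i _.
rewrite coef_trunc_exp ?leq_ord// coef_trunc ?leq_subr//.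
rewrite /fps_deriv; move: (fps_exp w k i) (v _) (k.+1%:R : Cplx R) (g k.+1).
by move=> a b c d; rewrite mulrCA !mulrA.
Qed.

(** The bound k W P^(k-1) for the slopes, in degree n, is a combination of the
    summable bounds for g' in the degrees up to n. *)
Lemma summable_slope (R : realType) (g : fps R) (rho : R) (P W : {poly R}) n :
  majorant_summable (fps_deriv g) rho ->
  P \is a nneg_poly -> P`_0 = rho -> W \is a nneg_poly ->
  bounded_sums (fun k => modulus (g k) * (W * P ^+ k.-1 *+ k)`_n).
Proof.
move=> Q P0 Pr W0; apply: bounded_sums_shift.
apply: (@bounded_sums_le _ _ (fun k => \sum_(i < n.+1)
  (fun i k => modulus (fps_deriv g k) * (P ^+ k)`_(n - i) * W`_i) i k)).
  move=> k; rewrite coefMn coefM -mulr_natl !mulr_sumr; apply: ler_sum => i _.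
  rewrite modulusM modulus_nat le_eqVlt; apply/orP; left; apply/eqP => /=; ring.
apply: (@bounded_sums_sum _ _
  (fun i k => modulus (fps_deriv g k) * (P ^+ k)`_(n - i) * W`_i)) => i _.
apply: bounded_sumsM; last exact: Q.
exact: nneg_poly_coef_ge0.
Qed.

Lemma cvg_line (R : realType) (F : set_system (Cplx R)) {FF : Filter F}
    (w v : fps R) :
  t @[t --> F] --> (0 : Cplx R) ->
  forall i, (w + t *: v) i @[t --> F] --> w i.
Proof.
move=> F0 i; rewrite -[w i]addr0 -[X in w i + X](mul0r (v i)).
exact: (cvgD (cvg_cst _) (cvgM F0 (cvg_cst _))).
Qed.

(** The chain rule: the derivative of w -> g o w in the direction v is (g' o
    w) v. The filter F only has to stay in the disc of radius rho, which is
    what allows points w on its boundary. *)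
Lemma fps_comp_derivative (R : realType) (F : set_system (Cplx R))
    {FF : Filter F} (g w v : fps R) (rho : R) :
  majorant_summable g rho -> modulus (w 0%N) <= rho ->
  t @[t --> F] --> (0 : Cplx R) ->
  (\forall t \near F, t != 0) ->
  (\forall t \near F, modulus ((w + t *: v) 0%N) <= rho) ->
  forall n, diff_quotient (fps_comp g) w v t n @[t --> F] -->
            fps_mul (fps_comp (fps_deriv g) w) v n.
Proof.
move=> Q w0 F0 Fn0 Frho n.
have r0 : 0 <= rho by apply: le_trans w0; exact: modulus_ge0.
have Q' := summable_deriv Q.
rewrite -lim_slope0; last exact: summable_comp_dom Q' w0.
have H : \forall t \near F,
    limn (series (fun k => g k * (exp_slope (trunc n w) (trunc n v) k t)`_n)) =
    diff_quotient (fps_comp g) w v t n.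
  apply: filterS2 Fn0 Frho => t tn0 trho.
  have dom_t := summable_comp_dom Q trho.
  by rewrite (diff_quotientE n (summable_comp_dom Q w0) dom_t tn0).
apply: (cvg_trans (near_eq_cvg H)).
(* P dominates w and w + t v for small t, so it serves both ends of the
   slope; W takes care of the remaining factor v. *)
pose P := majorant n rho (fun i => modulus (w i) + 1).
pose W := majorant n (modulus (v 0%N)) (fun i => modulus (v i)).
have P0 : P \is a nneg_poly.
  by apply: majorant_nneg => // i; rewrite addr_ge0 ?modulus_ge0.
have W0 : W \is a nneg_poly.
  by apply: majorant_nneg => // *; exact: modulus_ge0.
have wP i : (i <= n)%N -> modulus (trunc n w)`_i <= P`_i.
  by apply: trunc_majorant => // j _; rewrite lerDl.
have vW i : (i <= n)%N -> modulus (trunc n v)`_i <= W`_i.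
  exact: trunc_majorant.
have bnd k t : (forall i, (i <= n)%N ->
      modulus (trunc n w + t *: trunc n v)`_i <= P`_i) ->
    modulus (g k * (exp_slope (trunc n w) (trunc n v) k t)`_n)
      <= modulus (g k) * (W * P ^+ k.-1 *+ k)`_n.
  move=> wt; rewrite modulusM ler_wpM2l ?modulus_ge0//.
  exact: exp_slope_majorant.
apply: (@tannery _ _ _ _
  (fun t k => g k * (exp_slope (trunc n w) (trunc n v) k t)`_n) _ _
  (summable_slope n Q' P0 (coef0_majorant _ _ _) W0)).
- by move=> k; apply: bnd; rewrite scale0r addr0.
- apply: (filterS2 FF _ Frho
    (near_coef_bounded n (@cvg_line _ _ _ w v F0))) => t trho tb k.
  apply: bnd => i lin; rewrite -trunc_line; exact: (trunc_majorant trho tb lin).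
- move=> k; apply: cvgM; first exact: cvg_cst.
  exact: cvg_exp_slope.
Qed.

(** * Coefficientwise convergence and admissible increments *)

Lemma cvg_fpsP (R : realType) (T : Type) (F : set_system T) {FF : Filter F}
    (a : T -> fps R) (f : fps R) :
  a t @[t --> F] --> f <-> forall n, a t n @[t --> F] --> f n.
Proof. exact: (@pointwise_cvgP _ _ (a @ F) f). Qed.

Lemma fps_hausdorff (R : realType) : hausdorff_space (fps R).
Proof. by apply: hausdorff_product => _; exact: norm_hausdorff. Qed.

Lemma cvg_coef (R : realType) (w : fps R) i :
  f i @[f --> nbhs w] --> w i.
Proof. by have /cvg_fpsP : f @[f --> nbhs w] --> w by exact: cvg_id. Qed.

Global Instance increments_filter (R : realType) (g w v : fps R) :
  Filter (increments g w v).
Proof. exact: within_filter. Qed.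

Lemma increments_cvg0 (R : realType) (g w v : fps R) :
  t @[t --> increments g w v] --> (0 : Cplx R).
Proof.
move=> A A0; rewrite /increments /within/=.
by apply: filterS (_ : \forall t \near 0^', A t) => //; exact: nbhs_dnbhs.
Qed.

Lemma increments_neq0 (R : realType) (g w v : fps R) :
  \forall t \near increments g w v, t != 0.
Proof.
by rewrite /increments; apply: filterS (nbhs_dnbhs_neq _).
Qed.

Lemma increments_dom (R : realType) (g w v : fps R) :
  \forall t \near increments g w v, comp_dom g (w + t *: v).
Proof. exact: withinT. Qed.

Lemma increments_line (R : realType) (g w v : fps R) :
  (w + t *: v) @[t --> increments g w v] --> w.
Proof. by apply/cvg_fpsP; apply: cvg_line; exact: increments_cvg0. Qed.

(** Properness makes limits along the increments unique, hence the value of dT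
    determined by the convergence of the quotients. *)
Lemma admissible_increments_proper (R : realType) (g w v : fps R) :
  admissible g w v -> ProperFilter (increments g w v).
Proof.
case=> t [tn0 t0 tdom]; split; last exact: increments_filter.
rewrite /increments /within/= => H.
have /t0 : nbhs (0 : Cplx R)
    [set x | x != 0 -> ~ comp_dom g (w + x *: v)] by [].
move=> /= [N _ HN]; exact: (HN N (leqnn N) (tn0 N) (tdom N)).
Qed.

(** * Regular points and admissible directions *)

(** The points at which smoothness is shown: g is summable against majorants
    at a radius rho which near w also bounds the constant coefficients of the
    series in the domain. This covers three situations at once: rho = 0 when g
    diverges off the origin, rho below the radius of convergence, and rho
    equal to it. *)
Definition regular_at (R : realType) (g : fps R) (rho : R) (w : fps R) : Prop :=
  [/\ majorant_summable g rho, modulus (w 0%N) <= rho &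
      \forall f \near w, comp_dom g f -> modulus (f 0%N) <= rho].

Lemma regular_comp_dom (R : realType) (g : fps R) (rho : R) (w : fps R) :
  regular_at g rho w -> comp_dom g w.
Proof. by case=> Q w0 _; exact: summable_comp_dom Q w0. Qed.

(** Regularity is open relative to the domain, with the same rho; iterated
    derivatives are therefore taken at regular points only. *)
Lemma near_regular (R : realType) (g : fps R) (rho : R) (w : fps R) :
  regular_at g rho w ->
  \forall f \near w, comp_dom g f -> regular_at g rho f.
Proof.
case=> Q _ H; have H' := nbhs_interior H.
by apply: filterS2 H H' => f f0 fnear fdom; split=> //; exact: f0.
Qed.

(** Admissibility does not depend on the regular point w, which is what lets
    the directions stay admissible along w + t v. For rho > 0 every direction
    is admissible because t is complex: a suitable argument of t points into
    the disc. *)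
Lemma admissibleE (R : realType) (g : fps R) (rho : R) (w v : fps R) :
  regular_at g rho w -> admissible g w v <-> (rho = 0 -> v 0%N = 0).
Proof.
case=> Q w0 near_w; split=> [[t [tn0 t0 tdom]] rho0|v0].
  have /cvg_fpsP : (w + t n *: v) @[n --> \oo] --> w.
    apply/cvg_fpsP => i; rewrite -[w i]addr0 -[X in w i + X](mul0r (v i)).
    exact: (cvgD (cvg_cst _) (cvgM t0 (cvg_cst _))).
  move=> /cvg_fpsP/(_ _ near_w)[N _ /(_ N (leqnn N) (tdom N))].
  have z0 (z : Cplx R) : modulus z <= rho -> z = 0.
    by move=> zr; apply/eqP; rewrite -modulus_eq0 eq_le modulus_ge0 -rho0 zr.
  move=> /z0 E; have := z0 _ w0 => w00; move: E.
  rewrite (_ : (w + _) _ = w 0%N + t N * v 0%N)// w00 add0r => /eqP.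
  by rewrite mulf_eq0 (negbTE (tn0 N)) => /eqP.
have r0 : 0 <= rho by apply: le_trans w0; exact: modulus_ge0.
(* z is a point of the closed disc to which the constant coefficient of w can
   be moved along v; any point other than that coefficient will do. *)
have [z zr zE] : exists2 z : Cplx R, modulus z <= rho & v 0%N = 0 \/ z != w 0%N.
  have [v00|vn0] := eqVneq (v 0%N) 0.
    by exists 0; [rewrite modulus0|left].
  have rn0 : rho != 0 by apply: contraNneq vn0 => /v0/eqP.
  have [w00|wn0] := eqVneq (w 0%N) 0.
    exists (rho%:C : Cplx R); first by rewrite modulusR.
    by right; rewrite w00 -modulus_eq0 modulusR.
  by exists 0; [rewrite modulus0|right; rewrite eq_sym].
(* If v_0 is nonzero and t = s c, the constant coefficient of w + t v is
   (1 - s) w_0 + s z, which lies in the disc by convexity. *)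
pose c : Cplx R := if v 0%N == 0 then 1 else (z - w 0%N) / v 0%N.
pose s n : Cplx R := n.+1%:R^-1.
have ms n : modulus (s n) = n.+1%:R^-1.
  rewrite /s -[RHS]modulusR ?invr_ge0//; congr modulus.
  by rewrite fmorphV rmorph_nat.
have ms1 n : modulus (1 - s n) = 1 - n.+1%:R^-1.
  have s1 : n.+1%:R^-1 <= 1 :> R by rewrite invf_le1// ler1n.
  rewrite -[RHS]modulusR ?subr_ge0//; congr modulus.
  by rewrite rmorphB rmorph1 fmorphV rmorph_nat.
exists (fun n => s n * c); split.
- move=> n; rewrite mulf_neq0 ?invr_eq0 ?pnatr_eq0// /c.
  case: ifPn => [_|vn0]; first by rewrite oner_eq0.
  rewrite mulf_neq0 ?invr_eq0// subr_eq0.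
  by case: zE => // v00; rewrite v00 eqxx in vn0.
- rewrite -[X in _ --> X](mul0r c); apply: cvgM; last exact: cvg_cst.
  apply/cvg_modulusP => e e0.
  have /cvgrPdist_lt/(_ _ e0) := @cvg_harmonic R; apply: filterS => n.
  rewrite !sub0r normrN modulusN ms ger0_norm//= /harmonic invr_ge0 ler0n//.
- move=> n; apply: (summable_comp_dom Q).
  rewrite (_ : (w + _) _ = w 0%N + s n * c * v 0%N)// /c.
  case: eqVneq => [->|vn0]; first by rewrite mulr0 addr0.
  rewrite -[s n * _ * _]mulrA divfK// mulrBr addrCA addrC.
  rewrite (_ : _ + _ = (1 - s n) * w 0%N + s n * z); last by ring.
  rewrite (le_trans (le_modulusD _ _))// !modulusM ms ms1.
  have conv (x a b : R) :
      0 <= x -> x <= 1 -> a <= rho -> b <= rho -> (1 - x) * a + x * b <= rho.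
    by move=> x0 x1 ar br; nra.
  by apply: conv => //; rewrite ?invr_ge0// invf_le1// ler1n.
Qed.

(** * Higher derivatives *)

(** The product A v_0 ... v_(m-1), formed from the last direction on. This is
    the order in which dT takes the directions, so that the induction step of
    the formula for dT holds by unfolding both recursions. *)
Fixpoint mul_dirs (R : realType) (A : fps R) m : ('I_m -> fps R) -> fps R :=
  match m with
  | 0 => fun=> A
  | m'.+1 => fun v => mul_dirs (fps_mul A (v ord_max)) (front_dirs v)
  end.

Lemma fps_mulZB (R : realType) (c : Cplx R) (A B v : fps R) :
  fps_mul (c *: (A - B)) v = c *: (fps_mul A v - fps_mul B v).
Proof.
apply/funext => n; rewrite /fps_mul.
transitivity (c * (\sum_(i < n.+1) A i * v (n - i)%N -
                   \sum_(i < n.+1) B i * v (n - i)%N)); last by [].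
rewrite -sumrB mulr_sumr; apply: eq_bigr => i _.
by rewrite -mulrBl mulrA.
Qed.

Lemma mul_dirsZB (R : realType) (c : Cplx R) (A B : fps R) m
    (v : 'I_m -> fps R) :
  mul_dirs (c *: (A - B)) v = c *: (mul_dirs A v - mul_dirs B v).
Proof. by elim: m v A B => [//|m IH] v A B /=; rewrite fps_mulZB IH. Qed.

Lemma cvg_mul_dirs (R : realType) (T : Type) (F : set_system T) {FF : Filter F}
    (a : T -> fps R) (A : fps R) m (V : T -> 'I_m -> fps R) (v : 'I_m -> fps R) :
  (forall n, a t n @[t --> F] --> A n) ->
  (forall i n, V t i n @[t --> F] --> v i n) ->
  forall n, mul_dirs (a t) (V t) n @[t --> F] --> mul_dirs A v n.
Proof.
elim: m a A V v => [//|m IH] a A V v aA Vv /=.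
apply: (IH (fun t => fps_mul (a t) (V t ord_max)) _ (fun t => front_dirs (V t))).
  exact: (cvg_fps_mul aA (Vv ord_max)).
by move=> i; exact: Vv.
Qed.

Lemma summable_derivn (R : realType) (g : fps R) (rho : R) m :
  majorant_summable g rho -> majorant_summable (iter m (@fps_deriv R) g) rho.
Proof. by move=> Q; elim: m => [//|m IH]; exact: summable_deriv. Qed.

(** The formula d^m T_g (w) (v) = (g^(m) o w) v_0 ... v_(m-1), by induction on
    m: the directions in front enter linearly and continuously, and the chain
    rule applies to g^(m). *)
Lemma dT_regular (R : realType) (g : fps R) (rho : R) m (w : fps R)
    (v : 'I_m -> fps R) :
  regular_at g rho w -> (forall i, admissible g w (v i)) ->
  has_dT g w v /\
  dT g w v = mul_dirs (fps_comp (iter m (@fps_deriv R) g) w) v.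
Proof.
elim: m w v => [|m IH] w v reg adm.
  by split=> //; exact: regular_comp_dom reg.
have PF := admissible_increments_proper (adm ord_max).
have near_inc : \forall t \near increments g w (v ord_max),
    regular_at g rho (w + t *: v ord_max) /\
    forall i, admissible g (w + t *: v ord_max) (front_dirs v i).
  have H := @increments_line _ g w (v ord_max) _ (near_regular reg).
  have D := increments_dom g w (v ord_max).
  apply: (filterS2 (increments_filter _ _ _) _ H D) => t /= reg_t dom_t.
  have {}reg_t := reg_t dom_t; split=> // i.
  by apply/(admissibleE _ reg_t)/(admissibleE _ reg); exact: adm.
have [hw dw] := IH w (front_dirs v) reg (fun i => adm _).
have [Q w0 _] := reg.
have cvg_dq : diff_quotient (fun x => dT g x (front_dirs v)) w (v ord_max)
    @ increments g w (v ord_max) -->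
    mul_dirs (fps_comp (iter m.+1 (@fps_deriv R) g) w) v.
  have E : \forall t \near increments g w (v ord_max),
      mul_dirs (diff_quotient (fps_comp (iter m (@fps_deriv R) g)) w (v ord_max) t)
        (front_dirs v) =
      diff_quotient (fun x => dT g x (front_dirs v)) w (v ord_max) t.
    apply: filterS near_inc => t [reg_t adm_t].
    by rewrite /diff_quotient mul_dirsZB dw (IH _ _ reg_t adm_t).2.
  apply: (cvg_trans (near_eq_cvg E)); apply/cvg_fpsP => n.
  apply: cvg_mul_dirs => [k|i k]; last exact: cvg_cst.
  apply: (fps_comp_derivative (summable_derivn m Q) w0).
  - exact: increments_cvg0.
  - exact: increments_neq0.
  - by apply: filterS near_inc => t [[_ ? _] _].
split; last by rewrite /=; apply: cvg_lim => //; exact: fps_hausdorff.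
split=> //.
  by apply: filterS near_inc => t [reg_t adm_t]; apply: (IH _ _ reg_t adm_t).1.
by apply/cvg_ex; eexists; exact: cvg_dq.
Qed.

(** The explicit formula for the derivatives is continuous in w and in the
    directions, since composition with g^(m) and products are. *)
Lemma smooth_at_regular (R : realType) (g : fps R) (S : set (fps R)) :
  (forall w, S w -> exists rho, regular_at g rho w) -> smooth_at_points g S.
Proof.
move=> Sreg; split.
- by move=> w /Sreg[rho /regular_comp_dom].
- move=> f /Sreg[rho [Q f0 near_f]]; apply/cvg_fpsP.
  apply: (fps_comp_cvg Q f0); first exact: near_f.
  by move=> i; apply: cvg_within_filter; exact: cvg_coef.
- move=> m _; split.
    by move=> w v /Sreg[rho reg] adm; exact: (dT_regular reg adm).1.
  apply/subspace_continuousP => -[w v] /= [Sw adm].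
  have [rho reg] := Sreg _ Sw; have [Q w0 near_w] := reg.
  set F := within _ _.
  have -> : from_subspace _ (fun p : fps R * {ptws 'I_m -> fps R} => dT g p.1 p.2)
      (w, v) = mul_dirs (fps_comp (iter m (@fps_deriv R) g) w) v.
    by move=> s; exact: (dT_regular reg adm).2.
  have F1 : p.1 @[p --> F] --> w.
    by apply: cvg_within_filter; exact: cvg_fst.
  have F2 i : p.2 i @[p --> F] --> v i.
    apply: cvg_within_filter.
    apply: (@cvg_comp _ _ _ snd (fun u : {ptws 'I_m -> fps R} => u i) _
      (nbhs (v : {ptws 'I_m -> fps R}))); first exact: cvg_snd.
    exact: (@proj_continuous _ (fun=> fps R) i).
  have E : \forall p \near F, mul_dirs (fps_comp (iter m (@fps_deriv R) g) p.1) p.2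
      = dT g p.1 p.2.
    apply: filterS (withinT _ _) => -[w' v'] /= [/Sreg[rho' reg'] adm'].
    by rewrite (dT_regular reg' adm').2.
  apply: (cvg_trans (near_eq_cvg E)); apply/cvg_fpsP.
  apply: (@cvg_mul_dirs _ _ _ _ (fun p => fps_comp _ p.1) _ _ snd);
    last by move=> i; apply/cvg_fpsP; exact: F2.
  apply: (fps_comp_cvg (summable_derivn m Q) w0); last exact/cvg_fpsP.
  have FS : \forall p \near F, S p.1 by apply: filterS (withinT _ _) => p [].
  have Fw : \forall p \near F, comp_dom g p.1 -> modulus (p.1 0%N) <= rho.
    exact: F1 near_w.
  apply: filterS2 Fw FS => p Hp /Sreg[rho' /regular_comp_dom/Hp].
  exact.
Qed.

(** * Majorant summability at the origin and inside the disc of convergence *)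

Lemma bounded_sums_shiftn (R : realType) m (B : nat -> R) :
  bounded_sums (fun k => B (k + m)%N) -> bounded_sums B.
Proof.
elim: m B => [|m IH] B.
  by under [X in bounded_sums X]eq_fun do rewrite addn0.
move=> H; apply: bounded_sums_shift; apply: IH.
by under [X in bounded_sums X]eq_fun do rewrite -addnS.
Qed.

Lemma nneg_drop (R : realType) (P : {poly R}) m :
  P \is a nneg_poly -> drop_poly m P \is a nneg_poly.
Proof.
by move=> P0; apply/polyOverP => i; rewrite coef_drop_poly; exact: (polyOverP P0).
Qed.

Lemma poly_const_drop (S : nzRingType) (P : {poly S}) m :
  (forall i, (0 < i < m)%N -> P`_i = 0) -> (0 < m)%N ->
  P = (P`_0)%:P + drop_poly m P * 'X^m.
Proof.
move=> H m0; rewrite -[LHS](poly_take_drop m); congr (_ + _).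
apply/polyP => -[|i]; rewrite coef_take_poly coefC /=; first by rewrite m0.
by case: ifP => // im; rewrite H.
Qed.

(** With constant coefficient 0, the power P^k has no terms of degree below k,
    so only finitely many k contribute to each degree. *)
Lemma summable0 (R : realType) (g : fps R) : majorant_summable g 0.
Proof.
move=> P _ P00 n; apply: (@bounded_sums_shiftn _ n.+1); exists 0 => N.
rewrite big1// => k _.
rewrite (@poly_const_drop _ P 1)//; last by case.
rewrite P00 add0r expr1 exprMn_comm; last exact: commr_polyX.
by rewrite coefMXn addnS ltnS leq_addl mulr0.
Qed.

Lemma bounded_sums_geometric (R : realType) (q : R) :
  0 <= q -> q < 1 -> bounded_sums (fun k => q ^+ k).
Proof.
move=> q0 q1; exists (1 - q)^-1 => N.
rewrite -[leRHS]mul1r ler_pdivlMr ?subr_gt0//.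
have := subrX1 q N; have : 0 <= q ^+ N by rewrite exprn_ge0.
lra.
Qed.

Lemma coef_le_horner (R : realType) (P : {poly R}) (s : R) n :
  P \is a nneg_poly -> 0 <= s -> P`_n * s ^+ n <= P.[s].
Proof.
move=> P0 s0; have [nP|nP] := ltnP n (size P); last first.
  rewrite nth_default// mul0r horner_coef sumr_ge0// => i _.
  by rewrite mulr_ge0 ?exprn_ge0 ?nneg_poly_coef_ge0.
rewrite horner_coef (bigD1 (Ordinal nP))//= lerDl sumr_ge0// => i _.
by rewrite mulr_ge0 ?exprn_ge0 ?nneg_poly_coef_ge0.
Qed.

(** At small arguments a polynomial is close to its constant coefficient. *)
Lemma horner_small (R : realType) (P : {poly R}) (r : R) :
  P \is a nneg_poly -> P`_0 < r -> exists2 s, 0 < s & P.[s] <= r.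
Proof.
move=> P0 Pr; pose D := drop_poly 1 P.
have D0 : D \is a nneg_poly by exact: nneg_drop.
have D1 : 0 <= D.[1].
  rewrite (le_trans _ (coef_le_horner 0 D0 ler01))//.
  by rewrite expr0 mulr1 nneg_poly_coef_ge0.
have [d0 r0] : 0 < D.[1] + 1 /\ 0 < r - P`_0 by split; lra.
(* s <= 1 gives D.[s] <= D.[1], so s D.[s] is at most r - P_0. *)
pose s := Num.min 1 ((r - P`_0) / (D.[1] + 1)).
have s0 : 0 < s by rewrite lt_min ltr01 divr_gt0.
have s1 : s <= 1 by rewrite ge_min lexx.
have sD : s * (D.[1] + 1) <= r - P`_0.
  by rewrite -ler_pdivlMr// ge_min lexx orbT.
exists s => //; rewrite [X in X.[s]](@poly_const_drop _ P 1)//; last by case.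
rewrite hornerD hornerC hornerM expr1 hornerX -/D.
have : D.[s] <= D.[1].
  rewrite !horner_coef; apply: ler_sum => i _.
  by rewrite ler_wpM2l ?nneg_poly_coef_ge0// expr1n exprn_ile1// ltW.
nra.
Qed.

(** Evaluating at a small s > 0 replaces the coefficient of P^k by P.[s]^k,
    and P.[s] can be kept below modulus z: the series is dominated by a
    geometric one. *)
Lemma summable_lt (R : realType) (g : fps R) (rho : R) (z : Cplx R) (M : R) :
  (forall k, modulus (g k * z ^+ k) <= M) -> 0 <= rho < modulus z ->
  majorant_summable g rho.
Proof.
move=> gM /andP[r0 rz] P P0 Pr n; set a := modulus z in rz.
have a0 : 0 < a by lra.
pose b := (rho + a) / 2; have [rb ba] : rho < b /\ b < a by rewrite /b; split; lra.
have [|s s0 Ps] := @horner_small _ P b P0; first by rewrite Pr.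
have b0 : 0 < b by lra.
(* (P^k)_n s^n <= P.[s]^k <= b^k, while modulus (g k) <= M / a^k. *)
apply: (@bounded_sums_le _ _ (fun k => (b / a) ^+ k * (M / s ^+ n))).
  move=> k; rewrite mulrA ler_pdivlMr ?exprn_gt0// -mulrA.
  have H : (P ^+ k)`_n * s ^+ n <= b ^+ k.
    rewrite (le_trans (coef_le_horner n (rpredX k P0) (ltW s0)))//.
    rewrite horner_exp lerXn2r ?nnegrE ?(ltW b0)//.
    rewrite (le_trans _ (coef_le_horner 0 P0 (ltW s0)))//.
    by rewrite mulr_ge0 ?exprn_ge0 ?nneg_poly_coef_ge0// ltW.
  rewrite (le_trans (ler_wpM2l (modulus_ge0 _) H))//.
  have -> : (b / a) ^+ k * M = b ^+ k * M / a ^+ k by rewrite expr_div_n mulrAC.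
  rewrite ler_pdivlMr ?exprn_gt0// mulrAC mulrC.
  by rewrite ler_wpM2l ?exprn_ge0 ?(ltW b0)// -modulusX -modulusM.
apply: bounded_sumsM.
  by rewrite divr_ge0 ?exprn_ge0 ?(ltW s0)// (le_trans _ (gM 0%N))// modulus_ge0.
apply: bounded_sums_geometric; first by rewrite divr_ge0 ?ltW.
by rewrite ltr_pdivrMr// mul1r.
Qed.

(** * Majorant summability on the circle of convergence *)

Lemma bounded_sums_telescope (R : realType) :
  bounded_sums (fun l => (l.+1%:R * l.+2%:R)^-1 : R).
Proof.
exists 1 => N; suff -> : \sum_(l < N) (l.+1%:R * l.+2%:R)^-1 = 1 - N.+1%:R^-1 :> R.
  by rewrite lerBlDr lerDl invr_ge0.
elim: N => [|N IH]; first by rewrite big_ord0 invr1 subrr.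
rewrite big_ord_recr/= IH.
have n1 : N.+1%:R != 0 :> R by rewrite pnatr_eq0.
have n2 : N.+2%:R != 0 :> R by rewrite pnatr_eq0.
have E : N.+2%:R = N.+1%:R + 1 :> R by rewrite -natr1.
rewrite E in n2 *; move: (N.+1%:R : R) n1 n2 => x x0 x1.
by field; rewrite x0 x1.
Qed.

Lemma sum_ord_vanish (V : nmodType) (F : nat -> V) m N :
  (m <= N)%N -> (forall i, (m <= i)%N -> F i = 0) ->
  \sum_(i < N) F i = \sum_(i < m) F i.
Proof.
move=> mN F0; rewrite -!(big_mkord xpredT F) (big_cat_nat _ mN)//=.
by rewrite [X in _ + X]big_nat [X in _ + X]big1 ?addr0// => i /andP[/F0].
Qed.

Lemma coef_exp_binomial (S : comNzRingType) (c : S) (h : {poly S}) n m k :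
  (forall i, (m <= i)%N -> (h ^+ i)`_n = 0) ->
  ((c%:P + h) ^+ k)`_n = \sum_(i < m) (c ^+ (k - i) *+ 'C(k, i)) * (h ^+ i)`_n.
Proof.
move=> h0; pose F i := (c ^+ (k - i) *+ 'C(k, i)) * (h ^+ i)`_n.
(* The sums up to k and up to m agree: beyond k the binomial coefficient
   vanishes, beyond m the power of h does. *)
transitivity (\sum_(i < k.+1) F i).
  rewrite exprDn coef_sum; apply: eq_bigr => i _.
  by rewrite coefMn -rmorphXn/= coefCM /F mulrnAl.
rewrite -(@sum_ord_vanish _ F k.+1 (maxn k.+1 m)) ?leq_maxl//; last first.
  by move=> i ki; rewrite /F bin_small// mulr0n mul0r.
apply: sum_ord_vanish; first exact: leq_maxr.
by move=> i /h0; rewrite /F => ->; rewrite mulr0.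
Qed.

(** The absolute value of the k-th term of the j-th derivative of g, divided
    by j!, at a point of modulus rho. *)
Definition binomial_weight (R : realType) (g : fps R) (rho : R) j k : R :=
  modulus (g k) * (rho ^+ (k - j) *+ 'C(k, j)).

(** Terms that stay bounded for every number of derivatives decay faster than
    any power of k, and are thus absolutely summable. *)
Lemma binomial_weight_sums (R : realType) (g : fps R) (rho : R) :
  0 <= rho -> (forall j, exists M, forall k, binomial_weight g rho j k <= M) ->
  forall i, bounded_sums (binomial_weight g rho i).
Proof.
move=> r0 H i; apply: (@bounded_sums_shiftn _ i.+2).
(* Two extra factors of k in the weight i + 2 leave the convergent series of
   1 / ((l + 1) (l + 2)). *)
have [M HM] := H i.+2.
apply: (@bounded_sums_le _ _ (fun l => (l.+1%:R * l.+2%:R)^-1 *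
  (rho ^+ 2 * (i.+1%:R * i.+2%:R) * M))); last first.
  apply: bounded_sumsM; last exact: bounded_sums_telescope.
  rewrite !mulr_ge0// ?exprn_ge0// (le_trans _ (HM 0%N))//.
  by rewrite mulr_ge0 ?modulus_ge0// mulrn_wge0// exprn_ge0.
move=> l; rewrite [leRHS]mulrC ler_pdivlMr ?mulr_gt0 ?ltr0n//.
have c0 : 0 <= rho ^+ 2 * (i.+1%:R * i.+2%:R) by rewrite !mulr_ge0 ?exprn_ge0.
apply: le_trans (ler_wpM2l c0 (HM (l + i.+2)%N)).
rewrite /binomial_weight le_eqVlt; apply/orP; left; apply/eqP.
have := mul_bin_left (l + i.+2) i; have := mul_bin_left (l + i.+2) i.+1.
rewrite (_ : l + i.+2 - i = l.+2)%N; last by lia.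
rewrite (_ : l + i.+2 - i.+1 = l.+1)%N; last by lia.
rewrite addnK => E1 E2.
have {}E1 : i.+2%:R * 'C(l + i.+2, i.+2)%:R = l.+1%:R * 'C(l + i.+2, i.+1)%:R :> R.
  by rewrite -!natrM E1.
have {}E2 : i.+1%:R * 'C(l + i.+2, i.+1)%:R = l.+2%:R * 'C(l + i.+2, i)%:R :> R.
  by rewrite -!natrM E2.
rewrite -[_ *+ 'C(_, i)]mulr_natl -[_ *+ 'C(_, i.+2)]mulr_natl.
rewrite (_ : rho ^+ l.+2 = rho ^+ l * rho ^+ 2); last first.
  by rewrite -exprD addn2.
move: E1 E2; move: ('C(_, i.+2)%:R : R) ('C(_, i.+1)%:R : R) ('C(_, i)%:R : R).
move: (l.+1%:R : R) (l.+2%:R : R) (i.+1%:R : R) (i.+2%:R : R).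
move: (modulus _) (rho ^+ l) (rho ^+ 2) => m x y l1 l2 i1 i2 d2 d1 d0 E1 E2.
transitivity (m * x * y * l1 * (l2 * d0)); first by ring.
rewrite -E2; transitivity (m * x * y * i1 * (l1 * d1)); first by ring.
by rewrite -E1; ring.
Qed.

(** Expanding (rho + h)^k, with h divisible by X, leaves in degree n finitely
    many weighted series, one for each power of h up to n. *)
Lemma summable_weight (R : realType) (g : fps R) (rho : R) :
  0 <= rho -> (forall j, exists M, forall k, binomial_weight g rho j k <= M) ->
  majorant_summable g rho.
Proof.
move=> r0 H P P0 Pr n; have bw := binomial_weight_sums r0 H.
pose h := drop_poly 1 P * 'X.
have h0 : h \is a nneg_poly by rewrite rpredM ?nneg_drop// polyOverX.
have hn i : (n.+1 <= i)%N -> (h ^+ i)`_n = 0.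
  move=> ni; rewrite /h exprMn_comm; last exact: commr_polyX.
  by rewrite coefMXn ni.
apply: (@bounded_sums_le _ _ (fun k => \sum_(i < n.+1)
   (fun i k => binomial_weight g rho i k * (h ^+ i)`_n) i k)).
  move=> k; rewrite [X in X ^+ k](@poly_const_drop _ P 1)//; last by case.
  rewrite expr1 -/h Pr (coef_exp_binomial _ _ hn) mulr_sumr.
  by apply: ler_sum => i _; rewrite mulrA.
apply: (@bounded_sums_sum _ _
  (fun i k => binomial_weight g rho i k * (h ^+ i)`_n)) => i _.
by apply: bounded_sumsM => //; rewrite nneg_poly_coef_ge0// rpredX.
Qed.

Definition bounded_seq (R : realType) (u : nat -> Cplx R) : Prop :=
  exists M, forall N, modulus (u N) <= M.

Lemma cvg_bounded_seq (R : realType) (u : nat -> Cplx R) :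
  cvgn u -> bounded_seq u.
Proof.
move=> /cvg_ex[l /cvg_modulusP/(_ _ ltr01)[K _ HK]].
exists (modulus l + 1 + \sum_(k < K) modulus (u k)) => N.
have [KN|NK] := leqP K N.
  have := le_modulusD l (- (l - u N)); rewrite modulusN.
  rewrite (_ : l + - (l - u N) = u N); last by ring.
  have : modulus (l - u N) < 1 := HK N KN.
  have : 0 <= \sum_(k < K) modulus (u k).
    by rewrite sumr_ge0// => *; exact: modulus_ge0.
  lra.
rewrite (bigD1 (Ordinal NK))//= addrCA lerDl addr_ge0 ?addr_ge0 ?modulus_ge0//.
by rewrite sumr_ge0// => *; exact: modulus_ge0.
Qed.

Lemma bounded_seqB (R : realType) (u v : nat -> Cplx R) :
  bounded_seq u -> bounded_seq v -> bounded_seq (fun N => u N - v N).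
Proof.
move=> [M uM] [M' vM]; exists (M + M') => N.
by rewrite (le_trans (le_modulusD _ _))// modulusN lerD.
Qed.

Lemma bounded_seqM (R : realType) (u : nat -> Cplx R) (c : Cplx R) :
  bounded_seq u -> bounded_seq (fun N => u N * c).
Proof.
move=> [M uM]; exists (M * modulus c) => N.
by rewrite modulusM ler_wpM2r ?modulus_ge0.
Qed.

Lemma bounded_seq_sum (R : realType) n (u : nat -> nat -> Cplx R) :
  (forall i, (i < n)%N -> bounded_seq (u i)) ->
  bounded_seq (fun N => \sum_(i < n) u i N).
Proof.
elim: n => [|n IH] H; first by exists 0 => N; rewrite big_ord0 modulus0.
have [M HM] := IH (fun i Hi => H i (ltnW Hi)); have [M' HM'] := H n (ltnSn n).
exists (M + M') => N; rewrite big_ord_recr/=.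
by rewrite (le_trans (le_modulusD _ _))// lerD.
Qed.

Lemma bounded_series_term (R : realType) (u : nat -> Cplx R) :
  bounded_seq (series u) -> bounded_seq u.
Proof.
move=> [M uM]; exists (M + M) => N.
rewrite (_ : u N = series u N.+1 - series u N); last first.
  by rewrite !seriesEnat/= big_nat_recr//= addrAC subrr add0r.
by rewrite (le_trans (le_modulusD _ _))// modulusN lerD.
Qed.

(** With p the order of f - f_0, the coefficients of g o f in the degrees 0,
    p, 2p, ... involve the derivatives of g at f_0 one after the other, each
    with a nonzero factor. *)
Lemma comp_dom_weight (R : realType) (g f : fps R) q j :
  comp_dom g f -> f q.+1 != 0 ->
  bounded_seq (series (fun k => g k * (f 0%N ^+ (k - j) *+ 'C(k, j)))).
Proof.
move=> gf fq.
have exq : exists q, f q.+1 != 0 by exists q.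
case: (ex_minnP exq) => {q fq exq} p fp minp.
have fz i : (0 < i < p.+1)%N -> f i = 0.
  case: i => // i /andP[_ ip]; apply/eqP; apply: contraTT ip => /minp.
  by rewrite -ltnNge ltnS.
(* With f = f_0 + h and h of order p + 1, only h^0, ..., h^j reach the degree
   n = j (p + 1), and (h^j)_n = f_(p+1)^j is invertible: the series of degree n
   determines the series of weight j from those of smaller weight. *)
elim/ltn_ind: j => j IH; pose n := (j * p.+1)%N.
pose h := drop_poly p.+1 (trunc n f) * 'X^(p.+1).
have fE : trunc n f = (f 0%N)%:P + h.
  rewrite -[f 0%N](@coef_trunc _ n)//; apply: poly_const_drop => // i ip.
  by rewrite coef_poly; case: ifP => // _; exact: fz.
have hE i : h ^+ i = drop_poly p.+1 (trunc n f) ^+ i * 'X^(p.+1 * i).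
  by rewrite /h exprMn_comm ?exprM//; exact: commr_polyXn.
have h0 i : (j.+1 <= i)%N -> (h ^+ i)`_n = 0.
  by move=> ji; rewrite hE coefMXn /n mulnC ltn_pmul2l// ji.
have hj : (h ^+ j)`_n = f p.+1 ^+ j.
  rewrite hE coefMXn /n [(p.+1 * j)%N]mulnC ltnn subnn -horner_coef0 horner_exp.
  case: (posnP j) => [->|j0]; first by rewrite !expr0.
  rewrite horner_coef0 coef_drop_poly add0n coef_trunc//.
  by rewrite /n leq_pmull.
pose S i := series (fun k => g k * (f 0%N ^+ (k - i) *+ 'C(k, i))).
have E N : S j N = (comp_series g f n N - \sum_(i < j) S i N * (h ^+ i)`_n)
     * (f p.+1 ^+ j)^-1.
  apply: (mulIf (expf_neq0 j fp)); rewrite divfK ?expf_neq0// -hj.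
  apply/eqP; rewrite eq_sym subr_eq addrC; apply/eqP.
  rewrite -(big_ord_recr j (fun i => S i N * (h ^+ i)`_n)).
  rewrite /comp_series seriesEnat/= big_mkord.
  under [RHS]eq_bigr do rewrite /S seriesEnat/= big_mkord mulr_suml.
  rewrite exchange_big; apply: eq_bigr => k _ /=.
  rewrite -(@coef_trunc_exp _ n)// fE (coef_exp_binomial _ _ h0) mulr_sumr.
  by apply: eq_bigr => i _; rewrite mulrA.
rewrite -/(S j) (funext E); apply: bounded_seqM; apply: bounded_seqB.
  exact: cvg_bounded_seq (gf n).
apply: (@bounded_seq_sum _ _ (fun i N => S i N * (h ^+ i)`_n)) => i ij.
exact: bounded_seqM (IH i ij).
Qed.

Lemma summable_nonconst (R : realType) (g f : fps R) q :
  comp_dom g f -> f q.+1 != 0 -> majorant_summable g (modulus (f 0%N)).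
Proof.
move=> gf fq; apply: summable_weight; first exact: modulus_ge0.
move=> j; have [M HM] := bounded_series_term (comp_dom_weight j gf fq).
exists M => k; apply: le_trans (HM k).
by rewrite modulusM -mulr_natl modulusM modulus_nat modulusX mulr_natl.
Qed.

(** * The domain and the radius of convergence *)

(** In degree 0 the composition is the series g evaluated at the constant
    coefficient. *)
Lemma comp_dom_radius (R : realType) (g f : fps R) :
  comp_dom g f -> ((modulus (f 0%N))%:E <= radius_of_convergence g)%E.
Proof.
move=> gf; have E k : fps_exp f k 0 = f 0%N ^+ k.
  elim: k => [//|k IH]; rewrite exprS -IH /fps_exp iterS /fps_mul.
  by rewrite big_ord_recl big_ord0 addr0.
apply: ereal_sup_ubound; exists (f 0%N); last by [].
have := gf 0%N; rewrite /comp_series.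
by under [X in series X]eq_fun do rewrite E.
Qed.

Theorem theorem3p8 (R : realType) (g : fps R) :
  (radius_of_convergence g = 0%E -> smooth g) /\
  ((0 < radius_of_convergence g)%E ->
   smooth_at_points g
     [set f : fps R | comp_dom g f /\
        (((modulus (f 0%N))%:E < radius_of_convergence g)%E \/
         [/\ (radius_of_convergence g < +oo)%E,
             (modulus (f 0%N))%:E = radius_of_convergence g &
             (0 < fps_deg f)%E])]).
Proof.
split=> [r0|_]; apply: smooth_at_regular => w.
  have dom0 f : comp_dom g f -> modulus (f 0%N) <= 0.
    by move=> /comp_dom_radius; rewrite r0 lee_fin.
  move=> gw; exists 0; split; [exact: summable0|exact: dom0|].
  by apply: (@nearW _ (nbhs w)) => f; exact: dom0.
case=> gw [wr|[_ wr degw]].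
  have [_ [z gz <-]] := ereal_sup_gt wr; rewrite lte_fin => wz.
  pose rho := (modulus (w 0%N) + modulus z) / 2.
  have [wrho rhoz] : modulus (w 0%N) < rho /\ rho < modulus z.
    by rewrite /rho; split; lra.
  exists rho; split.
  - have [M HM] := bounded_series_term (cvg_bounded_seq gz).
    apply: (summable_lt HM); rewrite rhoz andbT.
    exact: le_trans (modulus_ge0 _) (ltW wrho).
  - exact: ltW.
  - have d0 : 0 < rho - modulus (w 0%N) by rewrite subr_gt0.
    have /cvg_modulusP/(_ _ d0) := @cvg_coef _ w 0.
    apply: filterS => f fw _; have := le_modulusD (w 0%N) (- (w 0%N - f 0%N)).
    rewrite modulusN (_ : w 0%N + - (w 0%N - f 0%N) = f 0%N); last by ring.
    lra.
have [_ [n wn <-]] := ereal_sup_gt degw; rewrite lte_fin ltr0n => n0.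
exists (modulus (w 0%N)); split=> //.
  by apply: (@summable_nonconst _ _ _ n.-1) => //; rewrite prednK.
by apply: (@nearW _ (nbhs w)) => f /comp_dom_radius; rewrite -wr lee_fin.
Qed.
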